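(* Let $\mathcal{C}$ be a bounded below graded poset and let $H:\mathcal{C}\to\mathrm{Ab}$ be a functor. Then $H$ is a projective object of the abelian category $\mathrm{Ab}^{\mathcal{C}}$ if and only if both of the following hold: (1) $\operatorname{Coker}(i_0)$ is a projective object of $\mathrm{Ab}$ for each object $i_0$ of $\mathcal{C}$; (2) $H$ is pseudo-projective.
   Context: A poset is regarded as a category with exactly one arrow $p\to p'$ when $p\le p'$ and none otherwise. For $p<p'$, $p$ precedes $p'$ if $p\le p''\le p'$ implies $p''=p$ or $p''=p'$. A graded poset is a poset together with an (increasing) degree function $\deg:\mathrm{Ob}(\mathcal{C})\to\mathbb{Z}$ which is strictly order preserving and such that $\deg(p')=\deg(p)+1$ whenever $p$ precedes $p'$. It is bounded below if the set of values of $\deg$ has a lower bound. The degree of an arrow $p\to p'$ is $|\deg(p')-\deg(p)|$. For $H:\mathcal{C}\to\mathrm{Ab}$ and an object $i_0$, $\operatorname{Im}(i_0)\subseteq H(i_0)$ is the subgroup generated by the images of all $H(\alpha)$ with $\alpha:i\to i_0$, $\alpha\ne 1_{i_0}$ (it is $0$ if there is no such $\alpha$), and $\operatorname{Coker}(i_0)=H(i_0)/\operatorname{Im}(i_0)$. $H$ is pseudo-projective if for every integer $d\ge 0$ the following holds: for any object $i_0$, any finite collection of pairwise different objects $i_1,\dots,i_k$, arrows $\alpha_j:i_j\to i_0$ with $\deg(\alpha_j)=d$ and elements $x_j\in H(i_j)$ ($j=1,\dots,k$) with $\sum_{j=1}^k H(\alpha_j)(x_j)=0$, we have $x_j\in\operatorname{Im}(i_j)$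 for all $j=1,\dots,k$. *)

(* Defs.v *)
From HB Require Import structures.
From mathcomp Require Import all_boot all_order all_algebra.
From mathcomp Require Import boolp classical_sets.

Set Implicit Arguments.
Unset Strict Implicit.
Unset Printing Implicit Defensive.

Import Order.TTheory GRing.Theory Num.Theory.
Local Open Scope classical_set_scope.
Local Open Scope ring_scope.

Record category := Category {
  cat_ob :> Type;
  cat_hom : cat_ob -> cat_ob -> Type;
  cat_id : forall A, cat_hom A A;
  cat_comp : forall A B D, cat_hom B D -> cat_hom A B -> cat_hom A D;
  cat_comp1m : forall A B (f : cat_hom A B), cat_comp (cat_id B) f = f;
  cat_compm1 : forall A B (f : cat_hom A B), cat_comp f (cat_id A) = f;
  cat_compA : forall A B D E (h : cat_hom D E) (g : cat_hom B D) (f : cat_hom A B),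
    cat_comp h (cat_comp g f) = cat_comp (cat_comp h g) f
}.
Arguments cat_hom {c} A B.
Arguments cat_id {c} A.
Arguments cat_comp {c A B D} g f : rename.

Record functor (C D : category) := Functor {
  fobj :> C -> D;
  fmap : forall p q : C, cat_hom p q -> cat_hom (fobj p) (fobj q);
  fmap1 : forall p, fmap (cat_id p) = cat_id (fobj p);
  fmapM : forall p q r (g : cat_hom q r) (f : cat_hom p q),
    fmap (cat_comp g f) = cat_comp (fmap g) (fmap f)
}.
Arguments fmap {C D} f {p q} a : rename.

Record nat_trans (C D : category) (F G : functor C D) := NatTrans {
  ntobj :> forall p : C, cat_hom (F p) (G p);
  nt_natural : forall (p q : C) (a : cat_hom p q),
    cat_comp (ntobj q) (fmap F a) = cat_comp (fmap G a) (ntobj p)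
}.

Lemma nat_trans_ext (C D : category) (F G : functor C D)
    (s t : nat_trans F G) : (forall p, s p = t p) -> s = t.
Proof.
case: s => s ns; case: t => t nt /= st.
have e : s = t by apply: functional_extensionality_dep.
by case: _ / e in nt *; congr NatTrans; apply: Prop_irrelevance.
Qed.

Section FunctorCategory.
Variables C D : category.

Program Definition nt_id (F : functor C D) : nat_trans F F :=
  @NatTrans C D F F (fun p => cat_id (F p)) _.
Next Obligation. by rewrite cat_comp1m cat_compm1. Qed.

Program Definition nt_comp (F G K : functor C D)
    (t : nat_trans G K) (s : nat_trans F G) : nat_trans F K :=
  @NatTrans C D F K (fun p => cat_comp (t p) (s p)) _.
Next Obligation. by rewrite -cat_compA nt_natural cat_compA nt_natural cat_compA. Qed.

Program Definition functor_cat : category :=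
  @Category (functor C D) (@nat_trans C D) nt_id nt_comp _ _ _.
Next Obligation. by apply: nat_trans_ext => p; exact: cat_comp1m. Qed.
Next Obligation. by apply: nat_trans_ext => p; exact: cat_compm1. Qed.
Next Obligation. by apply: nat_trans_ext => p; exact: cat_compA. Qed.

End FunctorCategory.

Definition epi (C : category) (A B : C) (e : cat_hom A B) : Prop :=
  forall (D : C) (u v : cat_hom B D), cat_comp u e = cat_comp v e -> u = v.

Definition projective (C : category) (P : C) : Prop :=
  forall (A B : C) (e : cat_hom A B) (f : cat_hom P B),
    epi e -> exists g : cat_hom P A, cat_comp e g = f.

Lemma additive_ext (A B : zmodType) (f g : {additive A -> B}) :
  f =1 g -> f = g.
Proof.
case: f => f [[cf]]; case: g => g [[cg]] /= fg.
have e : f = g by apply: functional_extensionality_dep.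
case: _ / e in cg *.
by rewrite (Prop_irrelevance cf cg).
Qed.

Definition additive_id (A : zmodType) : {additive A -> A} := idfun.
Definition additive_comp (A B D : zmodType)
  (g : {additive B -> D}) (f : {additive A -> B}) : {additive A -> D} := g \o f.

Lemma add_comp1m (A B : zmodType) (f : {additive A -> B}) :
  additive_comp (additive_id B) f = f.
Proof. exact: additive_ext. Qed.

Lemma add_compm1 (A B : zmodType) (f : {additive A -> B}) :
  additive_comp f (additive_id A) = f.
Proof. exact: additive_ext. Qed.

Lemma add_compA (A B D E : zmodType) (h : {additive D -> E})
    (g : {additive B -> D}) (f : {additive A -> B}) :
  additive_comp h (additive_comp g f) = additive_comp (additive_comp h g) f.
Proof. exact: additive_ext. Qed.

(* [zmodType] also asks for a choice operator and a boolean equality; by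
   classical choice every abelian group has them, so this is all of Ab. *)
Definition Ab : category :=
  @Category zmodType (fun A B => {additive A -> B}) additive_id additive_comp
    add_comp1m add_compm1 add_compA.

Section PosetCategory.
Variables (disp : Order.disp_t) (C : porderType disp).

Definition poset_cat : category :=
  @Category C (fun p q => is_true (p <= q)%O) (@lexx _ C)
    (fun p q r (b : (q <= r)%O) (a : (p <= q)%O) => le_trans a b)
    (fun _ _ _ => bool_irrelevance _ _)
    (fun _ _ _ => bool_irrelevance _ _)
    (fun _ _ _ _ _ _ _ => bool_irrelevance _ _).

Definition precedes (p q : C) : Prop :=
  (p < q)%O /\ forall r : C, (p <= r)%O -> (r <= q)%O -> r = p \/ r = q.

Definition is_degree (deg : C -> int) : Prop :=
  (forall p q : C, (p < q)%O -> deg p < deg q) /\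
  (forall p q : C, precedes p q -> deg q = deg p + 1).

Definition bounded_below (deg : C -> int) : Prop := has_lbound (range deg).

Definition arrow_deg (deg : C -> int) (p q : C) (a : (p <= q)%O) : nat :=
  `|deg q - deg p|%N.

Section Coker.
Variable H : functor poset_cat Ab.

Definition Hobj (p : C) : zmodType := H p.
Definition Hmap (p q : C) (a : (p <= q)%O) : {additive Hobj p -> Hobj q} :=
  fmap H a.

(* An arrow [a : i <= i0] is an identity exactly when its source is [i0]. *)
Definition Im_gens (i0 : C) : set (Hobj i0) :=
  [set y | exists (i : C) (a : (i <= i0)%O) (x : Hobj i),
             i <> i0 /\ Hmap a x = y].
Arguments Im_gens : clear implicits.

Definition Im (i0 : C) : set (Hobj i0) :=
  smallest (fun K : set (Hobj i0) => zmod_closed (mem K)) (Im_gens i0).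
Arguments Im : clear implicits.

Definition Im_pred (i0 : C) : {pred Hobj i0} := mem (Im i0).
Arguments Im_pred : clear implicits.

Lemma Im_zmod_closed (i0 : C) : zmod_closed (Im_pred i0).
Proof.
split=> [|x y /set_mem xI /set_mem yI]; apply/mem_set => K [Kz KS].
  by have [/set_mem] := Kz.
have [_ KB] := Kz; apply: set_mem; apply: KB; apply/mem_set.
  exact: xI.
exact: yI.
Qed.

HB.instance Definition _ (i0 : C) :=
  GRing.isZmodClosed.Build (Hobj i0) (Im_pred i0) (Im_zmod_closed i0).

Definition Coker (i0 : C) : zmodType := Quotient.quot (Im_pred i0).

Definition pseudo_projective (deg : C -> int) : Prop :=
  forall (d : nat) (i0 : C) (k : nat) (i : 'I_k -> C)
         (a : forall j, (i j <= i0)%O) (x : forall j, Hobj (i j)),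
    injective i ->
    (forall j, arrow_deg deg (a j) = d) ->
    \sum_(j < k) Hmap (a j) (x j) = 0 ->
    forall j, Im (i j) (x j).

End Coker.
End PosetCategory.

Arguments Im_gens {disp C} H i0 _.
Arguments Im {disp C} H i0 _.
Arguments Im_pred {disp C} H i0 _.
Arguments Coker {disp C} H i0.

(* Main.v *)
Require Import Defs.
From HB Require Import structures.
From mathcomp Require Import all_boot all_order all_algebra.
From mathcomp Require Import boolp classical_sets.
From mathcomp Require Import zify.

(* Necessity: lift the map from H to the functor with value Coker(p) at p alone
   along epimorphisms onto such functors.  Lifting through the same kind of
   functor shows that Coker(p) is projective; lifting through the functor equal
   to Coker(p) on the up-set of p shows pseudo-projectivity, because that functor
   vanishes at the other objects of the same degree and its arrows are injective.

   Sufficiency: choose sections of H(p) -> Coker(p).  Since degrees are bounded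
   below, each element of H(q) is a finite sum of images of section values at
   objects p <= q.  The sum is unique: push the terms of a vanishing sum up to
   objects of the maximal degree N occurring in it, which exist between p and q
   because the poset is graded; pseudo-projectivity puts each collected term in Im, and
   in Coker(p) with deg p = N only the original coefficient survives.  A map out
   of H may thus be prescribed freely on the section values. *)

Set Implicit Arguments.
Unset Strict Implicit.
Unset Printing Implicit Defensive.

Import Order.TTheory GRing.Theory Num.Theory.
Local Open Scope ring_scope.
Local Open Scope quotient_scope.

Local Notation Im := Defs.Im.

Lemma additive_eq (A B : zmodType) (f g : {additive A -> B}) (x : A) :
  f = g -> f x = g x.
Proof. by move=> ->. Qed.

(** Serves for maps defined through representatives or by choice, whose additivity is proved only
    afterwards. *)
Lemma exists_additive (A B : zmodType) (f : A -> B) :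
  zmod_morphism f -> exists g : {additive A -> B}, g =1 f.
Proof.
move=> fB; pose m := GRing.isZmodMorphism.Build A B f fB.
by exists (HB.pack_for {additive A -> B} f m).
Qed.

(** * Groups switched on or off by a boolean *)

Section Gate.
Variables (b : bool) (A : zmodType).

Definition gate_pred : {pred A} := [pred x | b || (x == 0)].

Lemma gate_zmod_closed : zmod_closed gate_pred.
Proof.
split=> [|x y]; rewrite !inE ?eqxx ?orbT //.
by case: b => //= /eqP -> /eqP ->; rewrite subr0.
Qed.

HB.instance Definition _ := GRing.isZmodClosed.Build A gate_pred gate_zmod_closed.

(* [A] if [b], the zero group otherwise *)
Record gated := Gated { gval : A; gvalP : gval \in gate_pred }.
HB.instance Definition _ := [isSub for gval].
HB.instance Definition _ := [Choice of gated by <:].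
HB.instance Definition _ := [SubChoice_isSubZmodule of gated by <:].

Lemma gvalN (x : gated) : ~~ b -> val x = 0.
Proof. by move=> /negPf nb; have := valP x; rewrite inE nb => /eqP. Qed.

Lemma gate_in (x : A) : (if b then x else 0) \in gate_pred.
Proof. by rewrite inE; case: b; rewrite ?eqxx ?orbT. Qed.

Definition gate (x : A) : gated := Gated (gate_in x).

Lemma val_gate x : val (gate x) = if b then x else 0. Proof. by []. Qed.

Lemma gateK (x : gated) : gate (val x) = x.
Proof. by apply: val_inj; rewrite val_gate; case: ifPn => // /gvalN ->. Qed.

Lemma gate_zmod_morphism : zmod_morphism gate.
Proof.
by move=> x y; apply: val_inj; rewrite raddfB /= ; case: b; rewrite ?subr0.
Qed.
HB.instance Definition _ := GRing.isZmodMorphism.Build A gated gate gate_zmod_morphism.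

Definition ungate : {additive gated -> A} := (val : gated -> A).

End Gate.
Arguments gate b {A} x.

(** * Functors constant on a convex set of objects and zero off it *)

Section Gated.
Variables (disp : Order.disp_t) (C : porderType disp).

(** Needed for functoriality: for [p <= q <= r] with only [q] outside [S], the composite would be
    zero but the direct arrow the identity. *)
Definition convex (S : pred C) :=
  forall p q r : C, (p <= q)%O -> (q <= r)%O -> S p -> S r -> S q.

Definition gated_map (S : pred C) (A : zmodType) (p q : C) :
    {additive gated (S p) A -> gated (S q) A} :=
  @gate (S q) A \o (val : gated (S p) A -> A).

Program Definition gated_functor (S : pred C) (cS : convex S) (A : zmodType) :
    functor (poset_cat C) Ab :=
  @Functor (poset_cat C) Ab (fun p => gated (S p) A)
    (fun p q _ => gated_map S A p q) _ _.
Next Obligation. by apply: additive_ext => x; apply: gateK. Qed.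
Next Obligation.
apply: additive_ext => x; apply: val_inj => /=.
case: ifPn => // Sr; case: ifPn => // nSq; rewrite (@gvalN _ _ x) //.
by apply: contra nSq => Sp; apply: (cS p q r).
Qed.

Section ToGated.
Variables (S : pred C) (cS : convex S) (A : zmodType) (F : functor (poset_cat C) Ab).
Variable h : forall p : C, {additive Hobj F p -> A}.
Hypothesis hP : forall (p q : C) (a : (p <= q)%O) (x : Hobj F p), S q ->
  h q (Hmap F a x) = if S p then h p x else 0.

(** Naturality has content only at targets in [S], where [hP] asks that [h] respect the arrows
    inside [S] and kill what arrives from outside. *)
Program Definition to_gated : nat_trans F (gated_functor cS A) :=
  @NatTrans (poset_cat C) Ab F (gated_functor cS A)
    (fun p => @gate (S p) A \o h p : {additive Hobj F p -> gated (S p) A}) _.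
Next Obligation.
apply: additive_ext => x; apply: val_inj => /=.
by case: ifP => // Sq; apply: (hP a).
Qed.

Lemma to_gatedE (p : C) (x : Hobj F p) : to_gated p x = gate (S p) (h p x).
Proof. by []. Qed.
End ToGated.

Section GatedGated.
Variables (S T : pred C) (cS : convex S) (cT : convex T) (A B : zmodType).
Hypothesis ST : forall p q : C, (p <= q)%O -> S p -> T q -> S q && T p.

(** For [p] in [S], [ST] opens every gate involved and both sides are [phi]; for [p] outside [S] the
    source group is zero. *)
Lemma gated_trans_subproof (phi : {additive A -> B}) (p q : C) (a : (p <= q)%O)
    (x : Hobj (gated_functor cS A) p) : T q ->
  (phi \o val : {additive Hobj (gated_functor cS A) q -> B}) (Hmap (gated_functor cS A) a x) =
  if T p then (phi \o val : {additive Hobj (gated_functor cS A) p -> B}) x else 0.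
Proof.
move=> Tq /=; move: (x : gated (S p) A) => {}x; case: (orP (orbN (S p))) => Sp.
  by case/andP: (ST a Sp Tq); move=> -> ->.
by rewrite (gvalN x Sp : gval x = 0) !(if_same, raddf0).
Qed.

Definition gated_trans (phi : {additive A -> B}) :
    nat_trans (gated_functor cS A) (gated_functor cT B) :=
  to_gated cT (gated_trans_subproof phi).

Lemma gated_trans_epi (phi : {additive A -> B}) : subpred T S ->
  @epi Ab A B phi -> @epi (functor_cat (poset_cat C) Ab) _ _ (gated_trans phi).
Proof.
move=> TS ephi D u v uv; apply: nat_trans_ext => p.
pose u' : {additive gated (T p) B -> Hobj D p} := u p.
pose v' : {additive gated (T p) B -> Hobj D p} := v p.
suff uv' x : u' (gate (T p) x) = v' (gate (T p) x).
  by apply: additive_ext => y; rewrite -(gateK y); apply: uv'.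
apply: (@additive_eq B (Hobj D p)
  (u' \o gate (T p)) (v' \o gate (T p))).
apply: ephi; apply: additive_ext => y /=.
case: (orP (orbN (T p))) => Tp; last first.
  have -> : gate (T p) (phi y) = 0 by apply: val_inj; rewrite val_gate (negPf Tp).
  by rewrite !raddf0.
have e : gate (T p) (phi y) = gated_trans phi p (gate (S p) y).
  by rewrite to_gatedE /= (TS p Tp).
rewrite e; have /(congr1 (fun w : nat_trans _ _ => w p)) /= := uv.
by move/(additive_eq (gate (S p) y)).
Qed.
End GatedGated.
End Gated.

Lemma epi_surj (A B : zmodType) (e : {additive A -> B}) :
  (forall y, exists x, e x = y) -> @epi Ab A B e.
Proof.
move=> sur D u v uv; apply: additive_ext => y; have [x <-] := sur y.
exact: (additive_eq (f := additive_comp u e) (g := additive_comp v e) x uv).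
Qed.

(** * Cokernels and the arrows of a functor on a poset *)

Section Cokernel.
Variables (disp : Order.disp_t) (C : porderType disp).
Variable H : functor (poset_cat C) Ab.

Definition coker_pi (p : C) : {additive Hobj H p -> Coker H p} :=
  (\pi_(Coker H p) : Hobj H p -> Coker H p).

Lemma coker_pi_surj (p : C) (c : Coker H p) : exists x, coker_pi p x = c.
Proof. by exists (repr c); apply: reprK. Qed.

Lemma coker_pi_eq0 (p : C) (x : Hobj H p) : coker_pi p x = 0 <-> Im H p x.
Proof.
rewrite -(raddf0 (coker_pi p)); split => [/eqP|xI].
  by rewrite -[_ == _]Quotient.idealrBE subr0 => /set_mem.
by apply/eqP; rewrite -[_ == _]Quotient.idealrBE subr0; apply/mem_set.
Qed.

Lemma Hmap_comp (p q r : C) (a : (p <= q)%O) (b : (q <= r)%O) (c : (p <= r)%O)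
    (x : Hobj H p) : Hmap H b (Hmap H a x) = Hmap H c x.
Proof.
rewrite (bool_irrelevance c (le_trans a b)).
exact: esym (additive_eq x (@fmapM _ _ H p q r b a)).
Qed.

Lemma Hmap_id (p : C) (a : (p <= p)%O) (x : Hobj H p) : Hmap H a x = x.
Proof.
rewrite (bool_irrelevance a (lexx p)).
exact: additive_eq x (@fmap1 _ _ H p).
Qed.

Lemma Im_Hmap (p q : C) (a : (p <= q)%O) (x : Hobj H p) :
  p != q -> Im H q (Hmap H a x).
Proof. by move=> /eqP npq K [_ KS]; apply: KS; exists p, a, x. Qed.

Lemma Im_ind (p : C) (P : Hobj H p -> Prop) :
  P 0 -> (forall x y, P x -> P y -> P (x - y)) ->
  (forall q (a : (q <= p)%O) x, (q < p)%O -> P (Hmap H a x)) ->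
  forall x, Im H p x -> P x.
Proof.
move=> P0 PB PH x /(_ [set y | P y]%classic); apply; split.
  split=> [|y z /set_mem Py /set_mem Pz]; first exact/mem_set.
  by apply/mem_set; apply: PB.
move=> y [q [a [z [/eqP npq <-]]]] /=; apply: PH.
by rewrite lt_neqAle npq.
Qed.

Lemma coker_factor (p : C) (B : zmodType) (h : {additive Hobj H p -> B}) :
  (forall x, Im H p x -> h x = 0) ->
  exists k : {additive Coker H p -> B}, forall x, k (coker_pi p x) = h x.
Proof.
(* The chosen representative of the class of [x] differs from [x] by an element of [Im], which [h]
   kills. *)
move=> h0; have hr x : h (repr (coker_pi p x)) = h x.
  apply/eqP; rewrite -subr_eq0 -raddfB; apply/eqP/h0/coker_pi_eq0.
  by rewrite raddfB; apply/eqP; rewrite subr_eq0; apply/eqP/reprK.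
have [c d|k kE] := @exists_additive (Coker H p) B (fun c => h (repr c)).
  have [[x <-] [y <-]] := (coker_pi_surj c, coker_pi_surj d).
  by rewrite -raddfB !hr raddfB.
by exists k => x; rewrite kE hr.
Qed.

(** The default zero lets sums over objects be written without order proofs. *)
Definition Hmap0 (p q : C) : {additive Hobj H p -> Hobj H q} :=
  if @idP (p <= q)%O is ReflectT a then Hmap H a else \0.

Lemma Hmap0E (p q : C) (a : (p <= q)%O) (x : Hobj H p) : Hmap0 p q x = Hmap H a x.
Proof.
by rewrite /Hmap0; case: {-}_ / idP => // b; rewrite (bool_irrelevance a b).
Qed.

Lemma Hmap0_id (p : C) (x : Hobj H p) : Hmap0 p p x = x.
Proof. by rewrite (Hmap0E (lexx p)) Hmap_id. Qed.

Lemma Hmap0_comp (p q r : C) (x : Hobj H p) : (p <= q)%O -> (q <= r)%O ->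
  Hmap0 q r (Hmap0 p q x) = Hmap0 p r x.
Proof.
move=> a b.
by rewrite (Hmap0E a) (Hmap0E b) (Hmap0E (le_trans a b)) (Hmap_comp a b (le_trans a b)).
Qed.

Lemma Im_Hmap0 (p q : C) (x : Hobj H p) : p != q -> Im H q (Hmap0 p q x).
Proof.
move=> npq; rewrite /Hmap0; case: {-}_ / idP => [a|_]; first exact: Im_Hmap.
by apply/coker_pi_eq0; rewrite raddf0.
Qed.

End Cokernel.

Lemma nat_trans_Hmap0 (disp : Order.disp_t) (C : porderType disp)
    (F G : functor (poset_cat C) Ab) (t : nat_trans F G) (p q : C) (x : Hobj F p) :
  (p <= q)%O ->
  (t q : {additive Hobj F q -> Hobj G q}) (Hmap0 F p q x) =
  Hmap0 G p q ((t p : {additive Hobj F p -> Hobj G p}) x).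
Proof.
move=> a; rewrite !(Hmap0E a).
exact: (additive_eq x (@nt_natural _ _ _ _ t p q a)).
Qed.

(** * Evaluation at an object and skyscraper functors *)

Section Projective.
Variables (disp : Order.disp_t) (C : porderType disp).

Lemma convex_eq (p0 : C) : convex [pred p | p == p0].
Proof.
move=> p q r pq qr /eqP pE /eqP rE; apply/eqP/le_anti.
by rewrite -{1}rE qr -pE.
Qed.

Lemma convex_ge (p0 : C) : convex [pred p | (p0 <= p)%O].
Proof. by move=> p q r pq _ pE _; apply: le_trans pE pq. Qed.

Lemma convex_le (p0 : C) : convex [pred p | (p <= p0)%O].
Proof. by move=> p q r _ qr _ rE; apply: le_trans qr rE. Qed.

Definition skyscraper (p0 : C) := gated_functor (@convex_eq p0).

(* Evaluation at [p0] preserves epimorphisms because it has a right adjoint,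
   [D |-> D] on the down-set of [p0]. *)
Lemma epi_eval (A B : functor (poset_cat C) Ab)
    (e : @cat_hom (functor_cat (poset_cat C) Ab) A B) (p0 : C) :
  epi e -> @epi Ab _ _ ((e : nat_trans A B) p0).
Proof.
move=> epi_e D u v uv.
pose h (w : {additive Hobj B p0 -> D}) (p : C) : {additive Hobj B p -> D} :=
  w \o Hmap0 B p p0.
have hP w (p q : C) (a : (p <= q)%O) (x : Hobj B p) : (q <= p0)%O ->
    h w q (Hmap B a x) = if (p <= p0)%O then h w p x else 0.
  by move=> qp; rewrite (le_trans a qp) /= -(Hmap0E a) Hmap0_comp.
pose adj w := to_gated (@convex_le p0) (hP w).
suff /(congr1 (fun t => @ntobj (poset_cat C) Ab _ _ t p0)) uv' : adj u = adj v.
  apply: additive_ext => x; have /(congr1 val) := additive_eq x uv'.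
  by rewrite /= lexx !Hmap0_id.
apply: epi_e; apply: nat_trans_ext => p; apply: additive_ext => x.
apply: val_inj => /=; case: ifP => // pp0.
rewrite -!(nat_trans_Hmap0 e) //.
exact: (additive_eq (f := additive_comp u (ntobj e p0))
  (g := additive_comp v (ntobj e p0)) _ uv).
Qed.

(** * Consequences of projectivity *)

Section Necessity.
Variable H : functor (poset_cat C) Ab.
Hypothesis projH : @projective (functor_cat (poset_cat C) Ab) H.

Lemma to_skyscraper_subproof (p0 : C) (B : zmodType)
    (f : {additive Coker H p0 -> B}) (p q : C) (a : (p <= q)%O) (x : Hobj H p) :
  q == p0 ->
  (f \o coker_pi H p0 \o Hmap0 H q p0 : {additive Hobj H q -> B}) (Hmap H a x) =
  if p == p0 then (f \o coker_pi H p0 \o Hmap0 H p p0 : {additive Hobj H p -> B}) x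
  else 0.
Proof.
move=> /eqP qE; rewrite /= -(Hmap0E a) Hmap0_comp // ?qE //.
case: ifPn => // np; rewrite qE in a.
by rewrite (Hmap0E a); have /coker_pi_eq0 -> := Im_Hmap a x np; rewrite raddf0.
Qed.

Definition to_skyscraper (p0 : C) (B : zmodType) (f : {additive Coker H p0 -> B}) :
    nat_trans H (skyscraper p0 B) :=
  to_gated (@convex_eq p0) (to_skyscraper_subproof f).

Lemma val_to_skyscraper (p0 : C) (B : zmodType) (f : {additive Coker H p0 -> B}) x :
  gval (to_skyscraper f p0 x) = f (coker_pi H p0 x).
Proof. by rewrite /= eqxx Hmap0_id. Qed.

(** Minimality of [p0] in [S] makes [e], placed at [p0] alone, a natural epimorphism from the
    functor on [S] onto the skyscraper. It is used with [S] equal to [p0] alone and to the up-set of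
    [p0]. *)
Lemma lift_skyscraper (p0 : C) (S : pred C) (cS : convex S) (A B : zmodType)
    (e : {additive A -> B}) (f : {additive Coker H p0 -> B}) :
  S p0 -> (forall p, (p <= p0)%O -> S p -> p = p0) -> @epi Ab A B e ->
  exists g : nat_trans H (gated_functor cS A),
    forall x, e (gval (g p0 x)) = f (coker_pi H p0 x).
Proof.
move=> Sp0 Smin epi_e.
have ST (p q : C) : (p <= q)%O -> S p -> q == p0 -> S q && (p == p0).
  by move=> pq Sp /eqP qE; rewrite qE in pq *; rewrite Sp0 (Smin p) ?eqxx.
have [|g gE] := projH (to_skyscraper f) (e := gated_trans cS (@convex_eq p0) ST e).
  by apply: gated_trans_epi => // p /eqP ->.
exists g => x; rewrite -val_to_skyscraper -gE /=.
by rewrite eqxx.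
Qed.

(** The lift to the skyscraper kills [Im], since elements arriving from below pass through zero
    groups; hence it descends to the cokernel. *)
Lemma projective_coker (p0 : C) : @projective Ab (Coker H p0).
Proof.
move=> A B e f epi_e.
have [//|p _ /eqP //|g gE] :=
  @lift_skyscraper p0 _ (@convex_eq p0) A B e f _ _ epi_e; first exact: eqxx.
pose g0 : {additive Hobj H p0 -> A} := 
    ungate (p0 == p0) A \o (g p0 : {additive Hobj H p0 -> gated (p0 == p0) A}).
have [x xI|k kE] := @coker_factor _ _ H p0 A g0.
  elim/Im_ind: x / xI => [|x y|p a x].
  - by rewrite raddf0.
  - by rewrite raddfB => -> ->; rewrite subr0.
  move=> plt; rewrite -(Hmap0E a) /g0 /= (nat_trans_Hmap0 g x a) (Hmap0E a).
  rewrite (_ : ntobj g p x = 0) ?raddf0 //; apply: val_inj.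
  by apply: gvalN; rewrite /= (lt_eqF plt).
exists k; apply: additive_ext => c; have [x <-] := coker_pi_surj c.
by rewrite -gE -[gval _]/(g0 x) -kE.
Qed.

Lemma projective_pseudo_projective (deg : C -> int) :
  (forall p q : C, (p < q)%O -> deg p < deg q) -> pseudo_projective H deg.
Proof.
move=> deg_lt d i0 k i a x inj_i deg_a sum0 j; apply/coker_pi_eq0.
set p0 := i j.
(* [g] extends the projection onto [Coker H p0] to a transformation into the functor constant on the
   up-set of [p0]. *)
have [|||g gE] := @lift_skyscraper p0 _ (@convex_ge p0) _ _
  (additive_id (Coker H p0)) (additive_id (Coker H p0)).
- exact: lexx.
- by move=> p pp0 p0p; apply/le_anti/andP.
- by apply: epi_surj => y; exists y.
rewrite -[LHS]gE /=.
pose g0 : {additive Hobj H i0 -> Coker H p0} :=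
  ungate (p0 <= i0)%O (Coker H p0) \o
    (g i0 : {additive Hobj H i0 -> gated (p0 <= i0)%O (Coker H p0)}).
(* Under [g0] the vanishing sum keeps only its [j]-th term, which naturality identifies with the
   class of [x j]. *)
rewrite -(raddf0 g0) -sum0 raddf_sum (bigD1 j) //= big1 ?addr0 => [|l nlj].
  rewrite -(Hmap0E (a j)) (nat_trans_Hmap0 g _ (a j)) (Hmap0E (a j)) /=.
  by rewrite (a j).
rewrite -(Hmap0E (a l)) (nat_trans_Hmap0 g _ (a l)) (Hmap0E (a l)) /=.
case: ifP => // _; apply: gvalN; apply/negP => /= p0l.
(* A strict inequality contradicts the equality of degrees; [deg_le] resolves the absolute values in
   the arrow degrees. *)
have {}p0l : (p0 < i l)%O.
  by rewrite lt_neqAle p0l andbT; apply: contra nlj => /eqP/inj_i ->.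
have deg_le q : (q <= i0)%O -> deg q <= deg i0.
  by rewrite le_eqVlt => /orP[/eqP ->|/deg_lt/ltW].
have := deg_lt _ _ p0l; have := deg_a j; have := deg_a l.
have := deg_le _ (a j); have := deg_le _ (a l); rewrite /arrow_deg -/p0.
lia.
Qed.

End Necessity.
End Projective.

(** * Objects of prescribed degree in a graded poset *)

Section Sufficiency.
Variables (disp : Order.disp_t) (C : porderType disp) (deg : C -> int).
Hypothesis hdeg : is_degree deg.

Lemma le_deg (p q : C) : (p <= q)%O -> deg p <= deg q.
Proof. by rewrite le_eqVlt => /orP[/eqP ->|/(proj1 hdeg)/ltW]. Qed.

(** Induction on the degree gap. If [m] is neither end degree, the gap exceeds one, so [p] does not
    precede [q]; an object strictly between them splits the interval. *)
Lemma exists_between_deg (p q : C) (m : int) : (p <= q)%O ->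
  deg p <= m -> m <= deg q -> exists r, [/\ (p <= r)%O, (r <= q)%O & deg r = m].
Proof.
have [n] := ubnP `|deg q - deg p|%N.
elim: n p q => // n IH p q; rewrite ltnS => nP pq pm mq.
have [mE|/eqP npm] := eqVneq (deg p) m; first by exists p.
have [mE|/eqP nqm] := eqVneq (deg q) m; first by exists q.
have plt : (p < q)%O.
  by rewrite lt_neqAle pq andbT; apply/eqP => pqE; rewrite pqE in pm npm; lia.
have [r [pr rq]] : exists r, (p < r)%O /\ (r < q)%O.
  apply: contrapT => nr; suff /(proj2 hdeg) : precedes p q by lia.
  split=> // r pr rq; have [->|rp] := eqVneq r p; [by left | right].
  have [//|rq'] := eqVneq r q; case: nr; exists r.
  by rewrite !lt_neqAle pr rq rq' eq_sym rp.
have := proj1 hdeg _ _ pr; have := proj1 hdeg _ _ rq => degrq degpr.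
have [mr|/ltW rm] := leP m (deg r).
- have [|s [ps sr sm]] := IH p r _ (ltW pr) pm mr; first by lia.
  by exists s; split=> //; apply: le_trans sr (ltW rq).
- have [|s [rs sq sm]] := IH r q _ (ltW rq) rm mq; first by lia.
  by exists s; split=> //; apply: le_trans (ltW pr) rs.
Qed.

(** * Sections of the cokernel maps and uniqueness of expansions *)

Variable H : functor (poset_cat C) Ab.
Hypothesis projC : forall i0 : C, @projective Ab (Coker H i0).
Hypothesis ppH : pseudo_projective H deg.

Lemma coker_section (p : C) : exists s : {additive Coker H p -> Hobj H p},
  forall c, coker_pi H p (s c) = c.
Proof.
have [|s sE] := projC (e := coker_pi H p) (additive_id (Coker H p)).
  exact/epi_surj/coker_pi_surj.
by exists s => c; apply: (additive_eq c sE).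
Qed.

Lemma pseudo_projective_seq (s : seq C) (q : C) (n : int) (y : forall p, Hobj H p) :
  uniq s -> (forall p, p \in s -> (p <= q)%O /\ deg p = n) ->
  \sum_(p <- s) Hmap0 H p q (y p) = 0 -> forall p, p \in s -> Im H p (y p).
Proof.
move=> us sP sum0 p ps.
pose i (j : 'I_(size s)) := tnth (in_tuple s) j.
have iP j : i j \in s by apply: mem_tnth.
have a j : (i j <= q)%O by case: (sP _ (iP j)).
have <- : i (Ordinal (etrans (index_mem p s) ps)) = p.
  by rewrite /i (tnth_nth p) /= nth_index.
apply: (@ppH `|deg q - n|%N q (size s) i a (fun j => y (i j))).
- by move=> j l; rewrite /i !(tnth_nth p) /= => /eqP; rewrite nth_uniq // => /eqP/val_inj.
- by move=> j; rewrite /arrow_deg; case: (sP _ (iP j)) => _ ->.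
- rewrite -[RHS]sum0 [RHS]big_tnth; apply: eq_bigr => j _.
  by rewrite (Hmap0E (a j)).
Qed.

Variable sec : forall p, {additive Coker H p -> Hobj H p}.
Hypothesis secK : forall p c, coker_pi H p (sec p c) = c.

Lemma section_sum_eq0 (s : seq C) (q : C) (c : forall p, Coker H p) :
  uniq s -> (forall p, p \in s -> (p <= q)%O) ->
  \sum_(p <- s) Hmap0 H p q (sec p (c p)) = 0 -> forall p, p \in s -> c p = 0.
Proof.
move=> us sq sum0 p ps; apply: contrapT => cp_neq0.
(* Zero coefficients are dropped so that the maximal degree is attained at a nonzero one. *)
pose t := [seq r <- s | c r != 0].
have pt : p \in t by rewrite mem_filter ps andbT; apply/eqP.
have tP r : r \in t -> (r <= q)%O by rewrite mem_filter => /andP[_ /sq].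
have {sum0}sum0 : \sum_(r <- t) Hmap0 H r q (sec r (c r)) = 0.
  rewrite /t big_filter -[RHS]sum0 big_mkcond; apply: eq_bigr => r _.
  by case: eqVneq => // ->; rewrite !raddf0.
have [p0 p0t p0max] : exists2 p0, p0 \in t & forall r, r \in t -> deg r <= deg p0.
  elim: (t) p pt {cp_neq0 ps} => // a l IH p _.
  have [->|] := eqVneq l [::].
    by exists a; rewrite ?mem_head // => r; rewrite inE => /eqP ->.
  case: l IH => // b l /(_ b (mem_head _ _))[p0 p0l p0max] _.
  have [ap0|p0a] := leP (deg a) (deg p0).
    exists p0 => [|r]; first by rewrite in_cons p0l orbT.
    by rewrite in_cons => /predU1P[->|/p0max].
  exists a => [|r]; rewrite ?mem_head // in_cons => /predU1P[->//|/p0max rp0].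
  exact: le_trans rp0 (ltW p0a).
(* [u] moves each object of [t] up to the maximal degree while staying below [q]; off [t] its value
   is arbitrary. *)
have /choice[u uP] (r : C) : exists u, r \in t ->
    [/\ (r <= u)%O, (u <= q)%O & deg u = deg p0].
  have [rt|_] := boolP (r \in t); last by exists r.
  have [u uP] := exists_between_deg (tP r rt) (p0max r rt) (le_deg (tP p0 p0t)).
  by exists u.
have up0 r : r \in t -> deg r = deg p0 -> u r = r.
  move=> rt degr; have [ru _ du] := uP r rt.
  have [//|nur] := eqVneq (u r) r.
  have /(proj1 hdeg) : (r < u r)%O by rewrite lt_neqAle eq_sym nur.
  by rewrite du degr ltxx.
pose y r := \sum_(v <- t | u v == r) Hmap0 H v r (sec v (c v)).
have : Im H p0 (y p0).
  apply: (@pseudo_projective_seq (undup (map u t)) q (deg p0) y).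
  - exact: undup_uniq.
  - by move=> r; rewrite mem_undup => /mapP[v vt ->]; have [] := uP v vt.
  - rewrite -[RHS]sum0.
    (* After exchanging the sums, each [v] contributes only at [u v], and mapping on to [q] restores
       its original term. *)
    under eq_bigr do rewrite raddf_sum big_mkcond.
    rewrite exchange_big /= !big_seq; apply: eq_bigr => v vt.
    rewrite (bigD1_seq (u v)) ?undup_uniq ?mem_undup ?map_f //= eqxx.
    rewrite big1 ?addr0 => [|r]; last by rewrite eq_sym => /negPf ->.
    by have [vu uq _] := uP v vt; rewrite Hmap0_comp.
  - by rewrite mem_undup -(up0 p0) // map_f.
have ut : uniq t by rewrite filter_uniq.
(* In the cokernel at [p0], terms from [v != p0] vanish, while [u p0 = p0] keeps [c p0], nonzero by
   the choice of [t]. *)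
move=> /coker_pi_eq0; rewrite raddf_sum big_mkcond (bigD1_seq p0) //= up0 // eqxx.
rewrite Hmap0_id secK big1 ?addr0 => [cp0|v nv].
  by move: p0t; rewrite mem_filter cp0 eqxx.
by case: ifP => // _; apply/coker_pi_eq0; apply: Im_Hmap0.
Qed.

Lemma sum_mem_uniq (I : eqType) (V : nmodType) (s t : seq I) (F : I -> V) :
  uniq s -> uniq t -> {subset s <= t} ->
  \sum_(i <- t) (if i \in s then F i else 0) = \sum_(i <- s) F i.
Proof.
move=> us ut st; rewrite -big_mkcond -big_filter; apply/perm_big/uniq_perm => //.
  exact: filter_uniq.
by move=> i; rewrite mem_filter; case: (boolP (i \in s)) => // /st ->.
Qed.

(** * Extending values prescribed on the sections *)

Section Lift.
Variables (A : functor (poset_cat C) Ab) (tau : forall p, {additive Coker H p -> Hobj A p}).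

(* The graph of the extension of [sec p c |-> tau p c] to a map [H -> A]. *)
Definition lift_graph (q : C) (x : Hobj H q) (y : Hobj A q) : Prop :=
  exists (s : seq C) (c : forall p, Coker H p),
  [/\ uniq s, forall p, p \in s -> (p <= q)%O,
      x = \sum_(p <- s) Hmap0 H p q (sec p (c p)) &
      y = \sum_(p <- s) Hmap0 A p q (tau p (c p))].

Lemma lift_graph0 (q : C) : @lift_graph q 0 0.
Proof. by exists [::], (fun=> 0); rewrite !big_nil. Qed.

(** Both expansions are padded with zero coefficients to the union of their supports. *)
Lemma lift_graphB (q : C) x1 x2 y1 y2 :
  @lift_graph q x1 y1 -> @lift_graph q x2 y2 -> lift_graph (x1 - x2) (y1 - y2).
Proof.
move=> [s [c [us sq -> ->]]] [t [d [ut tq -> ->]]].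
pose w := undup (s ++ t); have uw : uniq w := undup_uniq _.
have sw : {subset s <= w} by move=> p ps; rewrite mem_undup mem_cat ps.
have tw : {subset t <= w} by move=> p pt; rewrite mem_undup mem_cat pt orbT.
exists w, (fun p => (if p \in s then c p else 0) - (if p \in t then d p else 0)).
split=> // [p||].
- by rewrite mem_undup mem_cat => /orP[/sq|/tq].
- rewrite -(sum_mem_uniq _ us uw sw) -(sum_mem_uniq _ ut uw tw) -sumrB.
  by apply: eq_bigr => p _; rewrite !raddfB; do 2 case: ifP => _; rewrite ?raddf0.
- rewrite -(sum_mem_uniq _ us uw sw) -(sum_mem_uniq _ ut uw tw) -sumrB.
  by apply: eq_bigr => p _; rewrite !raddfB; do 2 case: ifP => _; rewrite ?raddf0.
Qed.

Lemma lift_graphD (q : C) x1 x2 y1 y2 :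
  @lift_graph q x1 y1 -> @lift_graph q x2 y2 -> lift_graph (x1 + x2) (y1 + y2).
Proof.
move=> g1 g2; rewrite -[x2]opprK -[y2]opprK; apply: lift_graphB => //.
by rewrite -[- x2]sub0r -[- y2]sub0r; apply: lift_graphB => //; apply: lift_graph0.
Qed.

Lemma lift_graph_Hmap0 (q r : C) x y : (q <= r)%O ->
  @lift_graph q x y -> lift_graph (Hmap0 H q r x) (Hmap0 A q r y).
Proof.
move=> qr [s [c [us sq -> ->]]]; exists s, c; split=> // [p /sq pq||].
- exact: le_trans pq qr.
- by rewrite raddf_sum !big_seq; apply: eq_bigr => p /sq pq; rewrite Hmap0_comp.
- by rewrite raddf_sum !big_seq; apply: eq_bigr => p /sq pq; rewrite Hmap0_comp.
Qed.

Lemma lift_graph_sec (q : C) (c : Coker H q) : lift_graph (sec q c) (tau q c).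
Proof.
(* The type of a coefficient depends on [p], so [c] is transported along [p = q]; at [q] itself the
   transport is trivial. *)
pose d p : Coker H p := if eqVneq p q is EqNotNeq pq then ecast z (Coker H z) (esym pq) c else 0.
have dq : d q = c.
  by rewrite /d; case: eqVneq => [qq|/eqP //]; rewrite (eq_axiomK qq).
exists [:: q], d; split=> // [p||].
- by rewrite inE => /eqP ->.
- by rewrite big_seq1 Hmap0_id dq.
- by rewrite big_seq1 Hmap0_id dq.
Qed.

Lemma lift_graph_functional (q : C) x y1 y2 :
  @lift_graph q x y1 -> lift_graph x y2 -> y1 = y2.
Proof.
move=> g1 g2; apply/eqP; rewrite -subr_eq0; apply/eqP.
have [s [c [us sq + ->]]] := lift_graphB g1 g2.
rewrite subrr => /esym/(section_sum_eq0 us sq) c0.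
by rewrite big_seq big1 // => p /c0 ->; rewrite !raddf0.
Qed.

(** Induction on the height of [deg q] above the lower bound: subtracting the section of the class
    of [x] leaves an element of [Im], which comes from objects of smaller degree. *)
Lemma lift_graph_total : bounded_below deg ->
  forall (q : C) (x : Hobj H q), exists y, lift_graph x y.
Proof.
move=> [m mP] q; have {mP}mP p : m <= deg p by apply: mP; exists p.
have [n] := ubnP `|deg q - m|%N.
elim: n q => // n IH q; rewrite ltnS => nP x.
have [y0 gy0] : exists y, lift_graph (x - sec q (coker_pi H q x)) y.
  have : Im H q (x - sec q (coker_pi H q x)).
    by apply/coker_pi_eq0; rewrite raddfB secK subrr.
  elim/Im_ind => [|x1 x2 [y1 g1] [y2 g2]|p a z pq].
  - by exists 0; apply: lift_graph0.
  - by exists (y1 - y2); apply: lift_graphB.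
  have [|w gw] := IH p _ z.
    by have := mP p; have := mP q; have := proj1 hdeg _ _ pq; lia.
  by exists (Hmap0 A p q w); rewrite -(Hmap0E a); apply: lift_graph_Hmap0.
exists (y0 + tau q (coker_pi H q x)).
rewrite -[x in lift_graph x](subrK (sec q (coker_pi H q x))).
by apply: lift_graphD => //; apply: lift_graph_sec.
Qed.

(** Additivity and naturality both follow from single-valuedness, as the two sides of each equation
    lie in the graph over one element. *)
Lemma exists_lift : bounded_below deg ->
  exists g : nat_trans H A, forall q x, lift_graph x (g q x).
Proof.
move=> hb.
have ex q : exists g : {additive Hobj H q -> Hobj A q}, forall x, lift_graph x (g x).
  have /choice[g0 g0P] := lift_graph_total hb (q := q).
  have [x y|g gE] := @exists_additive _ _ g0.
    exact: (lift_graph_functional (g0P _) (lift_graphB (g0P x) (g0P y))).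
  by exists g => x; rewrite gE.
pose g q := projT1 (cid (ex q)).
have gP q x : lift_graph x (g q x) by rewrite /g; case: cid.
have nat_g (p q : C) (a : (p <= q)%O) :
    additive_comp (g q) (Hmap H a) = additive_comp (Hmap A a) (g p).
  apply: additive_ext => x /=.
  rewrite -(Hmap0E a) -(Hmap0E a).
  exact: lift_graph_functional (gP _ _) (lift_graph_Hmap0 a (gP _ _)).
by exists (@NatTrans (poset_cat C) Ab H A g nat_g).
Qed.
End Lift.

Lemma pseudo_projective_projective : bounded_below deg ->
  @projective (functor_cat (poset_cat C) Ab) H.
Proof.
move=> hb A B e f epi_e.
pose ep p : {additive Hobj A p -> Hobj B p} := (e : nat_trans A B) p.
pose fp p : {additive Hobj H p -> Hobj B p} := (f : nat_trans H B) p.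
have ex p : exists tau : {additive Coker H p -> Hobj A p},
    forall c, ep p (tau c) = fp p (sec p c).
  (* Evaluation keeps [e] epi, so projectivity of [Coker H p] lifts [f] on the section values at
     [p]. *)
  have [tau tauE] := projC (additive_comp (fp p) (sec p)) (epi_eval (p0 := p) epi_e).
  by exists tau => c; apply: (additive_eq c tauE).
pose tau p := projT1 (cid (ex p)).
have tauE p c : ep p (tau p c) = fp p (sec p c) by rewrite /tau; case: cid.
have [g gP] := exists_lift tau hb.
exists g; apply: nat_trans_ext => q; apply: additive_ext => x.
rewrite -[LHS]/(ep q (g q x)) -[RHS]/(fp q x).
have [s [c [_ sq xE ->]]] := gP q x.
rewrite [in RHS]xE !raddf_sum !big_seq; apply: eq_bigr => p /sq pq.
by rewrite (nat_trans_Hmap0 e) // (nat_trans_Hmap0 f) // -/(ep p) -/(fp p) tauE.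
Qed.
End Sufficiency.

Theorem theorem6 (disp : Order.disp_t) (C : porderType disp) (deg : C -> int)
    (hdeg : is_degree deg) (hbelow : bounded_below deg)
    (H : functor (poset_cat C) Ab) :
  @projective (functor_cat (poset_cat C) Ab) H <->
    (forall i0 : C, @projective Ab (Coker H i0)) /\
    pseudo_projective H deg.
Proof.
split=> [projH|[projC ppH]].
  split; first exact: projective_coker.
  exact: projective_pseudo_projective (proj1 hdeg).
pose s p := cid (coker_section projC p).
apply: (@pseudo_projective_projective _ _ deg hdeg H projC ppH
  (fun p => projT1 (s p)) _ hbelow) => p c.
by case: (s p).
Qed.
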